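(* Let $(X,\tau)$ be a locally compact Hausdorff space with $\mathcal M^*(X)\ne\mathcal M(X)$. Then no $C_0(X)$-kernel is strictly integrally positive definite with respect to $\mathcal M(X)$.
   Context: A kernel on $X$ is a symmetric positive definite function $k:X\times X\to\mathbb R$ (i.e. $\sum_{i,j}a_ia_jk(x_i,x_j)\ge0$ for all finite choices). $C_0(X)$ is the space of continuous real functions on $X$ vanishing at infinity, with the supremum norm. A $C_0(X)$-kernel is a bounded and continuous kernel $k$ on $X$ whose reproducing kernel Hilbert space $H$ satisfies $H\subset C_0(X)$. $\mathcal M(X)$ is the space of all finite signed measures on the Borel $\sigma$-algebra $\mathcal B(X)$. A finite measure $\nu$ on $\mathcal B(X)$ is a finite Radon measure if for all $B\in\mathcal B(X)$ one has $\nu(B)=\sup\{\nu(K):K\text{ compact},K\subset B\}=\inf\{\nu(O):O\text{ open},B\subset O\}$; $\mathcal M^*(X)$ is the space of finite signed Radon measures, i.e. differences of two finite Radon measures. The kernel $k$ is strictly integrally positive definite with respect to $\mathcal M\subset\mathcal M(X)$ if $\int\int k(x,x')\,\mathrm d\mu(x)\,\mathrm d\mu(x')>0$ for all $\mu\in\mathcal M$ with $\mu\ne0$; this double integral equals $\|\Phi(\mu)\|_H^2$, where $\Phi(\mu)=\int_Xk(\cdot,x)\,\mathrm d\mu(x)\in H$ (Pettis integral). *)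

(* Defs.v *)
From HB Require Import structures.
From mathcomp Require Import all_boot all_order all_algebra.
From mathcomp Require Import all_classical all_reals all_analysis.

Set Implicit Arguments.
Unset Strict Implicit.
Unset Printing Implicit Defensive.

Import Order.TTheory GRing.Theory Num.Theory.
Import numFieldNormedType.Exports.

Local Open Scope classical_set_scope.
Local Open Scope ring_scope.

(* X is pointed because measurable types in the library are. *)
Definition borelType (X : ptopologicalType) := g_sigma_algebraType (@open X).

(* Charges are finite-valued, so this is the type of finite signed measures on
   the Borel sigma-algebra. Their values on non-measurable sets are arbitrary:
   charges are compared on measurable sets only, here and below. *)
Notation signed_measure R X := (charge (borelType X) R).

Definition charge_nonzero (R : realType) (X : ptopologicalType)
    (mu : signed_measure R X) : Prop :=
  exists2 B : set (borelType X), measurable B & mu B <> 0%E.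

Definition is_radon (R : realType) (X : ptopologicalType)
    (nu : {finite_measure set (borelType X) -> \bar R}) : Prop :=
  forall B : set (borelType X), measurable B ->
    nu B = ereal_sup [set nu K | K in [set K : set X | compact K /\ K `<=` B]] /\
    nu B = ereal_inf [set nu O | O in [set O : set X | open O /\ B `<=` O]].

Definition signed_radon (R : realType) (X : ptopologicalType) :
    set (signed_measure R X) :=
  [set mu : signed_measure R X | exists nu1 nu2 : {finite_measure set (borelType X) -> \bar R},
    [/\ is_radon nu1, is_radon nu2 &
      forall B, measurable B -> mu B = (nu1 B - nu2 B)%E]].

Arguments signed_radon R X : clear implicits.

Section charge_integral.
Context d (T : measurableType d) (R : realType).
Variable mu : {charge set T -> \bar R}.

Lemma hahn_ex : exists PN : set T * set T, hahn_decomposition mu PN.1 PN.2.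
Proof. by have [P [N PN]] := Hahn_decomposition mu; exists (P, N). Qed.

Definition charge_integral (f : T -> R) : R :=
  let PN := svalP (cid hahn_ex) in
  \int[jordan_pos PN]_x f x - \int[jordan_neg PN]_x f x.

End charge_integral.

Section kernels.
Variables (R : realType) (X : ptopologicalType).
Implicit Types (k : X -> X -> R) (H : set (X -> R))
  (dot : (X -> R) -> (X -> R) -> R).

Definition C0 : set (X -> R) :=
  [set f | continuous f /\
    forall e : R, 0 < e ->
      exists2 K : set X, compact K & forall x, ~ K x -> `|f x| < e].

Record is_kernel k : Prop := {
  kernel_sym : forall x y, k x y = k y x ;
  kernel_psd : forall n (x : 'I_n -> X) (a : 'I_n -> R),
    0 <= \sum_(i < n) \sum_(j < n) a i * a j * k (x i) (x j)
}.

(* H is the carrier of a Hilbert space of functions on X; the values of the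
   inner product dot outside H are irrelevant. *)
Record is_hilbert_function_space H dot : Prop := {
  hfs_0 : H (fun=> 0) ;
  hfs_lin : forall (a : R) f g, H f -> H g -> H (fun x => a * f x + g x) ;
  hfs_dot_sym : forall f g, H f -> H g -> dot f g = dot g f ;
  hfs_dot_lin : forall (a : R) f g h, H f -> H g -> H h ->
    dot (fun x => a * f x + g x) h = a * dot f h + dot g h ;
  hfs_dot_ge0 : forall f, H f -> 0 <= dot f f ;
  hfs_dot_eq0 : forall f, H f -> dot f f = 0 -> f = (fun=> 0) ;
  hfs_complete : forall u : nat -> X -> R, (forall n, H (u n)) ->
    (forall e : R, 0 < e -> exists N : nat, forall m n : nat,
      (N <= m)%N -> (N <= n)%N ->
      Num.sqrt (dot (u m \- u n) (u m \- u n)) < e) ->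
    exists2 f, H f &
      (fun n => Num.sqrt (dot (u n \- f) (u n \- f))) @ \oo --> (0 : R)
}.

Record is_rkhs k H dot : Prop := {
  rkhs_hilbert : is_hilbert_function_space H dot ;
  rkhs_section : forall x, H (k ^~ x) ;
  rkhs_reproducing : forall f x, H f -> f x = dot f (k ^~ x)
}.

(* By Moore-Aronszajn every kernel has exactly one RKHS, so the existential
   quantifier over (H, dot) just names it. *)
Record is_C0_kernel k : Prop := {
  C0_kernel_kernel : is_kernel k ;
  C0_kernel_bounded : exists M : R, forall x y, `|k x y| <= M ;
  C0_kernel_continuous : continuous (fun p : X * X => k p.1 p.2) ;
  C0_kernel_rkhs : exists H dot, is_rkhs k H dot /\ H `<=` C0
}.

Definition strictly_ipd (M : set (signed_measure R X)) k : Prop :=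
  forall mu, M mu -> charge_nonzero mu ->
    0 < charge_integral mu (fun x' => charge_integral mu (fun x => k x x')).

End kernels.
Arguments C0 {R X}.

(* Main.v *)
(* A finite Borel measure nu has a Radon companion nu' integrating every
   function of C_0(X) in the same way: let rho(U) be the supremum of nu over
   the compact subsets of an open set U, and nu'(A) the infimum of rho over
   the open sets containing A.  Then nu' is an outer measure whose
   Caratheodory sigma-algebra contains the open sets, and its restriction to
   the Borel sets is Radon.  It agrees with nu on open sigma-compact sets, in
   particular on {f > t} for f in C_0(X) and t >= 0, and the measures of these
   sets determine the integrals of f^+ and f^-.  (The total masses of nu and
   nu' may differ.)
   If mu = nu1 - nu2 is not Radon, then sigma = mu - (nu1' - nu2') is a nonzero
   charge that vanishes on C_0(X), hence on every section k(., y); so its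
   double integral against k is 0. *)
Require Import Defs.
From HB Require Import structures.
From mathcomp Require Import all_boot all_order all_algebra.
From mathcomp Require Import all_classical all_reals all_analysis.
From mathcomp Require Import measurable_realfun.

Set Implicit Arguments.
Unset Strict Implicit.
Unset Printing Implicit Defensive.

Import Order.TTheory GRing.Theory Num.Theory.
Import numFieldNormedType.Exports.

Local Open Scope classical_set_scope.
Local Open Scope ring_scope.

(** * Splitting a compact set covered by two open sets *)

Section compact_decomposition.
Context (X : topologicalType).
Hypotheses (X_lc : locally_compact [set: X]) (X_hausdorff : hausdorff_space X).

Lemma locally_compact_regular : regular_space X.
Proof.
move=> x; have [V nV [cV _]] := X_lc (I : [set: X] x).
apply: (compact_regular X_hausdorff cV).
by move: nV; rewrite withinET.
Qed.

(* [W] below is a neighbourhood of [K `\` U] whose closure meets [K] inside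
   [V]; regularity provides such a [W] locally and compactness of [K] glues. *)
Lemma compact_subsetU (K U V : set X) : compact K -> open U -> open V ->
  K `<=` U `|` V -> exists K1 K2 : set X,
    [/\ compact K1, compact K2, K1 `<=` U, K2 `<=` V & K = K1 `|` K2].
Proof.
move=> cK oU oV KUV.
have [KU0|/set0P KU0] := eqVneq (K `\` U) set0.
  exists K, set0; split; rewrite ?setU0//; first exact: compact0.
  by rewrite -setD_eq0.
have PF := set_nbhs_pfilter KU0.
have cvK : \forall W \near powerset_filter_from (set_nbhs (K `\` U)),
    K `<=` [set x | closure W x -> V x].
  have /compact_near_coveringP := cK; apply => x Kx.
  have [Vx|nVx] := pselect (V x).
    near=> y W => /= _.
    by near: y; exact: open_nbhs_nbhs.
  have Ux : U x by have [//|] := KUV _ Kx.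
  have [N Nx NU] := locally_compact_regular (open_nbhs_nbhs (conj oU Ux)).
  (* As [closure N] lies in [U], its complement is a neighbourhood of [K \ U]. Any [W] inside that
     complement misses [N], so no point near [x] belongs to [closure W]. *)
  have KN : set_nbhs (K `\` U) (~` closure N).
    move=> y [_ nUy]; apply: open_nbhs_nbhs; split.
      exact/closed_openC/closed_closure.
    by move=> /NU.
  near=> y W => /= Wy; exfalso.
  have WN : W `<=` ~` closure N by near: W; exact: small_set_sub.
  have [z [Wz Nz]] : W `&` N !=set0.
    by apply: Wy; near: y; exact: nbhs_interior.
  by apply: (WN z Wz); exact: subset_closure.
have /near_powerset_filter_fromP[|W /set_nbhsP[C [oC KC CW]] KWV] := cvK.
  by move=> A B AB KB x Kx /(closureS AB); exact: KB.
exists (K `\` C), (K `&` closure C); split.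
- by apply: compact_closedI => //; exact: open_closedC.
- by apply: compact_closedI => //; exact: closed_closure.
- by move=> x [Kx nCx]; apply: contrapT => nUx; apply: nCx; exact: KC.
- by move=> x [Kx /(closureS CW)]; exact: KWV.
- apply/seteqP; split=> [x Kx|x [[]|[]]//].
  have [Cx|] := pselect (C x); last by left.
  by right; split => //; exact: subset_closure.
Unshelve. all: by end_near. Qed.

End compact_decomposition.

Lemma borel_open (X : ptopologicalType) (U : set X) :
  open U -> measurable (U : set (borelType X)).
Proof. exact: sub_sigma_algebra. Qed.

Lemma borel_closed (X : ptopologicalType) (C : set X) :
  closed C -> measurable (C : set (borelType X)).
Proof.
move=> cC; rewrite -[C]setCK; apply: measurableC.
by apply: borel_open; exact: closed_openC.
Qed.

(** * The Radon companion of a finite Borel measure *)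

Section regularization.
Local Open Scope ereal_scope.
Context (R : realType) (X : ptopologicalType).
Hypotheses (X_lc : locally_compact [set: X]) (X_hausdorff : hausdorff_space X).
Variable nu : {finite_measure set (borelType X) -> \bar R}.

(** This is rho, and [open_inf] below is the outer measure nu' that it induces. *)
Definition compact_sup (U : set X) : \bar R :=
  ereal_sup [set nu K | K in [set K : set X | compact K /\ K `<=` U]].

Definition open_inf (A : set X) : \bar R :=
  ereal_inf [set compact_sup U | U in [set U : set X | open U /\ A `<=` U]].

Let borel_compact (K : set X) : compact K -> measurable (K : set (borelType X)).
Proof. by move=> cK; apply: borel_closed; exact: compact_closed. Qed.

Lemma compact_sup_ub (K U : set X) : compact K -> K `<=` U ->
  nu K <= compact_sup U.
Proof. by move=> cK KU; apply: ereal_sup_ubound; exists K. Qed.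

Lemma compact_sup_ge0 U : 0 <= compact_sup U.
Proof. by rewrite (le_trans _ (compact_sup_ub compact0 (@sub0set _ U))). Qed.

Lemma le_compact_sup U V : U `<=` V -> compact_sup U <= compact_sup V.
Proof.
move=> UV; apply: ge_ereal_sup => _ [K [cK KU] <-].
by apply: compact_sup_ub => //; exact: subset_trans UV.
Qed.

Lemma compact_sup_le (U : set X) : measurable (U : set (borelType X)) ->
  compact_sup U <= nu U.
Proof.
move=> mU; apply: ge_ereal_sup => _ [K [cK KU] <-].
by apply: le_measure => //; rewrite inE//; exact: borel_compact.
Qed.

Lemma compact_sup_fin U : compact_sup U \is a fin_num.
Proof.
rewrite ge0_fin_numE ?compact_sup_ge0//.
rewrite (le_lt_trans (le_compact_sup (@subsetT _ U)))//.
rewrite (le_lt_trans (compact_sup_le measurableT))// -ge0_fin_numE//.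
exact: fin_num_measure.
Qed.

Lemma compact_sup0 : compact_sup set0 = 0.
Proof.
apply/eqP; rewrite eq_le compact_sup_ge0 andbT.
by rewrite -(measure0 nu) compact_sup_le.
Qed.

(** A compact subset of the union splits into a compact part in [U] and one in [V]; this is where
    local compactness enters. *)
Lemma compact_supU U V : open U -> open V ->
  compact_sup (U `|` V) <= compact_sup U + compact_sup V.
Proof.
move=> oU oV; apply: ge_ereal_sup => _ [K [cK KUV] <-].
have [K1 [K2 [cK1 cK2 K1U K2V ->]]] :=
  compact_subsetU X_lc X_hausdorff cK oU oV KUV.
rewrite (le_trans (measureU2 _ _ _))//; try exact: borel_compact.
by apply: leeD; exact: compact_sup_ub.
Qed.

(** Each compact subset of the union meets only a finite subcover, which reduces the claim to finite
    subadditivity. *)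
Lemma compact_sup_bigcup (U : (set X)^nat) : (forall n, open (U n)) ->
  compact_sup (\bigcup_n U n) <= \sum_(n <oo) compact_sup (U n).
Proof.
move=> oU; apply: ge_ereal_sup => _ [K [cK KU] <-].
have oUn n : open (\big[setU/set0]_(i < n) U i).
  by rewrite -bigcup_mkord; exact: bigcup_open.
have [n Kn] : exists n, K `<=` \big[setU/set0]_(i < n) U i.
  move: cK; rewrite compact_cover => /(_ _ setT U).
  case=> [//|//|D _ KD]; exists (\max_(i <- finmap.enum_fset D) i).+1.
  move=> x /KD[i /= iD Uix].
  rewrite -bigcup_mkord; exists i => //=.
  by rewrite ltnS; exact: leq_bigmax_seq.
rewrite (le_trans (compact_sup_ub cK Kn))//.
apply: (@le_trans _ _ (\sum_(0 <= i < n) compact_sup (U i))); last first.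
  by apply: nneseries_lim_ge => *; exact: compact_sup_ge0.
rewrite big_mkord {Kn}; elim: n => [|n ih].
  by rewrite !big_ord0 compact_sup0.
rewrite !big_ord_recr/= (le_trans (compact_supU _ _))//.
  exact: oUn.
exact: leeD.
Qed.

Lemma le_open_inf A B : A `<=` B -> open_inf A <= open_inf B.
Proof.
move=> AB; apply: le_ereal_inf_tmp => _ [U [oU BU] <-].
by apply: ereal_inf_lbound; exists U => //; split => //; exact: subset_trans BU.
Qed.

Lemma open_inf_lb A U : open U -> A `<=` U -> open_inf A <= compact_sup U.
Proof. by move=> oU AU; apply: ereal_inf_lbound; exists U. Qed.

Lemma open_inf_open U : open U -> open_inf U = compact_sup U.
Proof.
move=> oU; apply/eqP; rewrite eq_le open_inf_lb//=.
by apply: le_ereal_inf_tmp => _ [V [oV UV] <-]; exact: le_compact_sup.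
Qed.

Lemma open_inf_ge0 A : 0 <= open_inf A.
Proof. by apply: le_ereal_inf_tmp => _ [U _ <-]; exact: compact_sup_ge0. Qed.

Lemma open_inf0 : open_inf set0 = 0.
Proof. by rewrite open_inf_open ?compact_sup0//; exact: open0. Qed.

Lemma open_inf_fin A : open_inf A \is a fin_num.
Proof.
rewrite ge0_fin_numE ?open_inf_ge0//.
apply: le_lt_trans (open_inf_lb openT (@subsetT _ A)) _.
by rewrite -ge0_fin_numE ?compact_sup_ge0// compact_sup_fin.
Qed.

Lemma open_inf_approx A (e : R) : (0 < e)%R ->
  exists U : set X, [/\ open U, A `<=` U & compact_sup U <= open_inf A + e%:E].
Proof.
move=> e0; have [_ [U [oU AU] <-] /ltW Ue] :=
  lb_ereal_inf_adherent e0 (open_inf_fin A).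
by exists U.
Qed.

Lemma compact_sup_approx U (e : R) : (0 < e)%R ->
  exists K : set X, [/\ compact K, K `<=` U & compact_sup U <= nu K + e%:E].
Proof.
move=> e0; have [_ [K [cK KU] <-]] :=
  ub_ereal_sup_adherent e0 (compact_sup_fin U).
by rewrite lteBlDr// => /ltW Ke; exists K.
Qed.

Lemma open_inf_sigma_subadditive : sigma_subadditive open_inf.
Proof.
move=> A; apply/lee_addgt0Pr => e e0.
(* The [n]-th set is approximated up to [e / 2 ^ n.+1], and these errors sum to [e]. *)
apply: le_trans (epsilon_trick xpredT (fun n => open_inf_ge0 (A n)) (ltW e0)).
have en n : (0 < e / (2 ^ n.+1)%:R)%R by rewrite divr_gt0// ltr0n expn_gt0.
have [U AU] := choice (fun n => open_inf_approx (A n) (en n)).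
apply: (@le_trans _ _ (\sum_(n <oo) compact_sup (U n))).
  apply: le_trans (compact_sup_bigcup _); last by move=> n; have [] := AU n.
  apply: open_inf_lb; first by apply: bigcup_open => n _; have [] := AU n.
  by apply: subset_bigcup => n _; have [] := AU n.
apply: lee_nneseries => [n _ _|n _]; first exact: compact_sup_ge0.
by have [] := AU n.
Qed.

Let outer : {outer_measure set X -> \bar R} := HB.pack open_inf
  (isOuterMeasure.Build R X open_inf open_inf0 open_inf_ge0 le_open_inf
     open_inf_sigma_subadditive).

Lemma compact_disjoint_sup (K L V : set X) : compact K -> compact L ->
  K `<=` V -> L `<=` V `\` K -> nu K + nu L <= compact_sup V.
Proof.
move=> cK cL KV LVK; rewrite -measureU//; try exact: borel_compact.
  apply: compact_sup_ub; first exact: compactU.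
  by rewrite subUset; split => // x /LVK[].
by apply/seteqP; split => // x [Kx /LVK[]].
Qed.

(** Let [V] be open around [A]. A compact [K] nearly exhausts [V & U], then a compact [L] nearly
    exhausts [V \ K]. The latter set replaces [V \ U], which need not be open: it is open, contains
    [A \ U], and keeps [L] disjoint from [K]. *)
Lemma open_inf_caratheodory (U : set X) : open U -> outer.-caratheodory U.
Proof.
move=> oU; apply: le_caratheodory_measurable => A /=.
apply: le_ereal_inf_tmp => _ [V [oV AV] <-].
apply/lee_addgt0Pr => e e0; have e20 : (0 < e / 2)%R by rewrite divr_gt0.
have [K [cK KVU Ke]] := compact_sup_approx (V `&` U) e20.
have [L [cL LVK Le]] := compact_sup_approx (V `\` K) e20.
have oVK : open (V `\` K).
  by apply: openI => //; apply: closed_openC; exact: compact_closed.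
apply: (@le_trans _ _ (compact_sup (V `&` U) + compact_sup (V `\` K))).
  apply: leeD; apply: open_inf_lb => //; first exact: openI.
  - exact: setSI.
  - by move=> x [/AV Vx nUx]; split => // /KVU[].
apply: le_trans (leeD Ke Le) _.
rewrite addeACA -EFinD -splitr leeD2r//.
by apply: compact_disjoint_sup => // x /KVU[].
Qed.

Lemma open_inf_borel (B : set (borelType X)) : measurable B ->
  outer.-cara.-measurable B.
Proof.
apply: smallest_sub; first exact: sigma_algebra_measurable.
exact: open_inf_caratheodory.
Qed.

Let open_inf_sigma_additive :
  semi_sigma_additive (open_inf : set (borelType X) -> \bar R).
Proof.
move=> F mF tF mUF.
apply: (@caratheodory_measure_sigma_additive R X outer) => //.
- by move=> n; exact: open_inf_borel.
- exact: open_inf_borel.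
Qed.

Let radon : {measure set (borelType X) -> \bar R} := HB.pack open_inf
  (isMeasure.Build _ (borelType X) R open_inf open_inf0 open_inf_ge0
     open_inf_sigma_additive).

Let radon_fin : fin_num_fun radon.
Proof. by move=> B _; exact: open_inf_fin. Qed.

Lemma le_compact_open_inf (K : set X) : compact K -> nu K <= open_inf K.
Proof.
move=> cK; apply: le_ereal_inf_tmp => _ [U [oU KU] <-].
exact: compact_sup_ub.
Qed.

Lemma open_inf_inner_approx (B : set (borelType X)) (e : R) :
  measurable B -> (0 < e)%R -> exists K : set X,
    [/\ compact K, K `<=` B & open_inf B <= open_inf K + e%:E].
Proof.
move=> mB e0; have e20 : (0 < e / 2)%R by rewrite divr_gt0.
have [U [oU BU Ue]] := open_inf_approx (~` B) e20.
have [K [cK _ Ke]] := compact_sup_approx setT e20.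
have cKU : compact (K `\` U).
  by apply: compact_closedI => //; exact: open_closedC.
exists (K `\` U); split => //.
  by move=> x [_ nUx]; apply: contrapT => /BU.
have mBC : measurable (~` B) by exact: measurableC.
rewrite -(leeD2rE _ _ (open_inf_fin (~` B))).
have -> : open_inf B + open_inf (~` B) = compact_sup setT.
  rewrite -open_inf_open; last exact: openT.
  have -> : [set: X] = B `|` ~` B by rewrite setUv.
  by rewrite -[RHS]/(radon (B `|` ~` B)) measureU// setICr.
apply: le_trans Ke _.
apply: le_trans (leeD2r _ (le_compact_open_inf cK)) _.
have KUU : K `<=` (K `\` U) `|` U.
  by move=> x Kx; have [|] := pselect (U x); [right|left].
apply: (@le_trans _ _ (open_inf (K `\` U) + open_inf U + (e / 2)%:E)).
  rewrite leeD2r// (le_trans (le_open_inf KUU))//.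
  exact: (outer_measureU2 outer).
rewrite (open_inf_open oU) -!addeA leeD2l//.
apply: le_trans (leeD2r _ Ue) _.
by rewrite -addeA -EFinD -splitr addeC.
Qed.

Lemma compact_sup_sigma_compact (K : (set X)^nat) :
  (forall n, compact (K n)) -> {homo K : m n / (m <= n)%N >-> m `<=` n} ->
  compact_sup (\bigcup_n K n) = nu (\bigcup_n K n).
Proof.
move=> cK ndK.
have mU : measurable (\bigcup_n K n : set (borelType X)).
  by apply: bigcupT_measurable => n; exact: borel_compact.
apply/eqP; rewrite eq_le compact_sup_le//=.
have nuK : nu (K n) @[n --> \oo] --> nu (\bigcup_n K n).
  apply: nondecreasing_cvg_mu => //.
  - by move=> n; exact: borel_compact.
  - by move=> m n mn; apply/subsetPset; exact: ndK.
rewrite -(cvg_lim _ nuK)//; apply: lime_le; first by apply: cvgP nuK.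
by apply: nearW => n; apply: compact_sup_ub => //; exact: bigcup_sup.
Qed.

Lemma open_inf_superlevel (f : X -> R) (t : R) : C0 f -> (0 <= t)%R ->
  open_inf (f @^-1` `]t, +oo[) = nu (f @^-1` `]t, +oo[).
Proof.
move=> [cf f0] t0; rewrite open_inf_open; last first.
  by apply: open_comp => // x _; exact: cf.
(* These closed sets are compact because their levels are positive even for [t = 0], and [f]
   vanishes at infinity. *)
pose K n := f @^-1` `[(t + n.+1%:R^-1)%R, +oo[%classic.
have -> : f @^-1` `]t, +oo[ = \bigcup_n K n.
  apply/seteqP; split=> [x|x [n _]] /=; rewrite in_itv/= andbT.
    move=> tfx; have [n] := ltr_add_invr tfx.
    by move=> /ltW tn; exists n => //; rewrite /K/= in_itv/= andbT.
  by rewrite /K/= !in_itv/= !andbT => /(lt_le_trans _); apply; rewrite ltrDl.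
apply: compact_sup_sigma_compact => [n|m n mn x].
  have e0 : (0 < t + n.+1%:R^-1)%R by rewrite ltr_wpDl.
  have [L cL fL] := f0 _ e0.
  apply: (subclosed_compact _ cL).
    by apply: preimage_closed; [move=> x _; exact: cf|exact: rray_closed].
  move=> x; rewrite /K/= in_itv/= andbT => fx.
  apply: contrapT => /fL; apply/negP; rewrite -leNgt.
  by rewrite (le_trans fx)// ler_norm.
rewrite /K/= !in_itv/= !andbT; apply: le_trans.
by rewrite lerD2l lef_pV2 ?posrE// ler_nat.
Qed.

Let finite_radon : {finite_measure set (borelType X) -> \bar R} :=
  HB.pack (Measure.sort radon) (Measure.class radon)
    (Measure_isFinite.Build _ _ _ (Measure.sort radon) radon_fin).

Lemma exists_radon_superlevel :
  exists2 m : {finite_measure set (borelType X) -> \bar R}, is_radon m &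
  forall (f : X -> R) (t : R), C0 f -> (0 <= t)%R ->
    m (f @^-1` `]t, +oo[) = nu (f @^-1` `]t, +oo[).
Proof.
exists finite_radon; last by move=> f t; exact: open_inf_superlevel.
move=> B mB; split; last first.
  (* Outer regularity is the definition of [open_inf], once [compact_sup] is identified with
     [open_inf] on open sets. *)
  rewrite -[LHS]/(open_inf B) {1}/open_inf; congr ereal_inf.
  apply: eq_imagel => U [oU _].
  exact/esym/open_inf_open.
apply/eqP; rewrite eq_le; apply/andP; split.
  apply/lee_addgt0Pr => e e0.
  have [K [cK KB Ke]] := open_inf_inner_approx mB e0.
  by apply: (le_trans Ke); rewrite leeD2r//; apply: ereal_sup_ubound; exists K.
by apply: ge_ereal_sup => _ [K [cK KB] <-]; exact: le_open_inf.
Qed.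

End regularization.

(** * Integrals determined by superlevel sets *)

Section integral_superlevel.
Local Open Scope ereal_scope.
Context d (T : measurableType d) (R : realType).
Variables (m1 m2 : {finite_measure set T -> \bar R}) (f : T -> R).
Hypotheses (mf : measurable_fun setT f) (f_ge0 : forall x, (0 <= f x)%R).

(** The point 0 is left out because the two measures may give different mass to the zero set of [f],
    which contributes nothing to the integrals. *)
Let D : set (measurableTypeR R) := `]0%R, +oo[%classic.

Let mD : measurable D. Proof. exact: measurable_itv. Qed.

Let integral_pushforward_pos (m : {measure set T -> \bar R}) :
  \int[m]_x (f x)%:E = \int[pushforward m f]_(y in D) y%:E.
Proof.
rewrite [RHS]ge0_integral_pushforward//; last first.
  by move=> y; rewrite inE /D/= in_itv/= andbT lee_fin => /ltW.
rewrite [RHS]integral_mkcond; apply: eq_integral => x _.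
rewrite patchE; case: ifPn => //; rewrite notin_setE /D/= in_itv/= andbT.
move/negP; rewrite -leNgt => fx; congr EFin; apply/eqP.
by rewrite eq_le fx f_ge0.
Qed.

Lemma eq_integral_superlevel :
  (forall t, (0 <= t)%R -> m1 (f @^-1` `]t, +oo[) = m2 (f @^-1` `]t, +oo[)) ->
  \int[m1]_x (f x)%:E = \int[m2]_x (f x)%:E.
Proof.
move=> m12; rewrite 2!integral_pushforward_pos.
apply: eq_measure_integral => A mA AD.
have mpf (m : {finite_measure set T -> \bar R}) (B : set (measurableTypeR R)) :
    measurable B -> pushforward m f B < +oo.
  move=> mB; rewrite ltey_eq fin_num_measure//.
  by rewrite -[X in measurable X]setTI; exact: mf.
suff : mrestr (pushforward m1 f) mD A = mrestr (pushforward m2 f) mD A.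
  by rewrite /mrestr (setIidl AD).
(* The open right rays form a pi-system generating the Borel sets of the line. Intersecting a ray
   with [D] raises its endpoint to at least 0, where the hypothesis applies. *)
apply: (measure_unique (@RGenOInfty.G R)
  (fun k : nat => `](- k%:R)%R, +oo[%classic)).
- exact: RGenOInfty.measurableE.
- move=> _ _ [x ->] [y ->]; exists (Num.max x y).
  apply/seteqP; split => z/=; rewrite !in_itv/= !andbT gt_max.
    by move=> [-> ->].
  by move=> /andP.
- by move=> k; exists (- k%:R)%R.
- apply/seteqP; split => // x _; exists (Num.bound `|x|%R) => //=.
  rewrite in_itv/= andbT; have := archi_boundP (normr_ge0 x).
  by rewrite ltr_norml => /andP[].
- move=> _ [t ->] /=.
  have tD : `]t, +oo[%classic `&` D = `](Num.max t 0)%R, +oo[%classic.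
    apply/seteqP; split => x; rewrite /D/= !in_itv/= !andbT gt_max.
      by move=> [-> ->].
    by move=> /andP.
  by rewrite /mrestr /pushforward tD; apply: m12; rewrite le_max lexx orbT.
- by move=> k; rewrite /mrestr mpf//; exact: measurableI.
- exact: mA.
Qed.

End integral_superlevel.

(** * Integration against a difference of finite measures *)

Section charge_integral_difference.
Context d (T : measurableType d) (R : realType).

(** [charge_integral] uses an arbitrarily chosen Hahn decomposition; this frees it from that choice.
    If [p] and [n] are the chosen Jordan parts, then [p + m2 = m1 + n] as measures, and the
    integrals, all finite as [f] is bounded, can be rearranged. *)
Lemma charge_integral_difference (sg : {charge set T -> \bar R})
    (m1 m2 : {measure set T -> \bar R}) (f : T -> R) :
  (m1 setT < +oo)%E -> (m2 setT < +oo)%E ->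
  measurable_fun setT f -> [bounded f x | x in setT] ->
  (forall B, measurable B -> sg B + m2 B = m1 B)%E ->
  charge_integral sg f = \int[m1]_x f x - \int[m2]_x f x.
Proof.
move=> fin1 fin2 mf bf sgE; rewrite /charge_integral.
set PN := svalP _; set p := jordan_pos PN; set n := jordan_neg PN.
have intf (m : {measure set T -> \bar R}) :
    (m setT < +oo)%E -> m.-integrable setT (EFin \o f).
  by move=> finm; exact: measurable_bounded_integrable.
have finp : (p setT < +oo)%E by rewrite ltey_eq fin_num_measure.
have finn : (n setT < +oo)%E by rewrite ltey_eq fin_num_measure.
have addE : (\int[measure_add p m2]_x (f x)%:E =
             \int[measure_add m1 n]_x (f x)%:E)%E.
  apply: eq_measure_integral => B mB _.
  rewrite -[LHS]/(measure_add p m2 B) -[RHS]/(measure_add m1 n B) !measure_addE.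
  have := jordan_decomp PN mB; rewrite /cadd/= cscaleN1/= -/p -/n => sgB.
  by rewrite -sgE// sgB addeAC subeK// fin_num_measure.
move: addE; rewrite !integral_measure_add//; try exact: intf.
have intE (m : {measure set T -> \bar R}) : (m setT < +oo)%E ->
    (\int[m]_x (f x)%:E = (\int[m]_x f x)%:E)%E.
  move=> finm; rewrite /Rintegral fineK//.
  by apply: integrable_fin_num => //; exact: intf.
rewrite !intE// -!EFinD => -[] pE.
by apply/eqP; rewrite subr_eq addrAC eq_sym subr_eq eq_sym pE.
Qed.

End charge_integral_difference.

(** * Measurability and integrals of functions in C_0(X) *)

Section C0_functions.
Context (R : realType) (X : ptopologicalType).
Implicit Types f : X -> R.

Lemma continuous_borel_measurable f : continuous f ->
  measurable_fun setT (f : borelType X -> R).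
Proof.
move=> cf; apply: (measurability _ (RGenOpens.measurableE R)) => //.
move=> _ [_ [a [b ->]] <-]; rewrite setTI; apply: borel_open.
apply: open_comp => [x _|]; [exact: cf|exact: interval_open].
Qed.

Lemma C0_bounded f : C0 f -> [bounded f x | x in setT].
Proof.
move=> [cf /(_ 1 ltr01)[K cK fK]].
have [M [Mr fM]] : bounded_set (f @` K).
  by apply: compact_bounded; apply: continuous_compact => //;
     exact: continuous_subspaceT.
exists (Num.max M 1); split; first exact: num_real.
move=> y; rewrite gt_max => /andP[My y1] x _ /=.
have [Kx|/fK/ltW fx] := pselect (K x); last by rewrite (le_trans fx)// ltW.
by apply: (fM _ My) => /=; exists x.
Qed.

Lemma C0_opp f : C0 f -> C0 (- f).
Proof.
move=> [cf f0]; split=> [x|e /f0[K cK fK]]; first by apply: cvgN; exact: cf.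
by exists K => // x /fK; rewrite normrN.
Qed.

Lemma C0_pos f : C0 f -> C0 (fun x => Num.max (f x) 0).
Proof.
move=> [cf f0]; split=> [x|e e0].
  by apply: continuous_max; [exact: cf|exact: cst_continuous].
have [K cK fK] := f0 _ e0; exists K => // x /fK.
by case: (leP (f x) 0); rewrite ?normr0.
Qed.

(** The superlevel criterion is for nonnegative functions, so it is applied to the positive parts of
    [f] and [- f], both again in C_0(X). *)
Lemma eq_integral_C0 (m1 m2 : {finite_measure set (borelType X) -> \bar R}) f :
  (forall (g : X -> R) (t : R), C0 g -> 0 <= t ->
    m1 (g @^-1` `]t, +oo[) = m2 (g @^-1` `]t, +oo[)) ->
  C0 f -> (\int[m1]_x (f x)%:E = \int[m2]_x (f x)%:E)%E.
Proof.
move=> m12 Cf.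
have pos (g : X -> R) : C0 g ->
    (\int[m1]_x (Num.max (g x) 0)%:E = \int[m2]_x (Num.max (g x) 0)%:E)%E.
  move=> /C0_pos Cg; apply: (@eq_integral_superlevel _ (borelType X)) => //.
  - by apply: continuous_borel_measurable; case: Cg.
  - by move=> x; rewrite le_max lexx orbT.
  - by move=> t; exact: m12.
rewrite integralE [RHS]integralE; congr (_ - _)%E.
  rewrite (_ : _^\+ = fun x => (Num.max (f x) 0)%:E)%E; first exact: pos.
  by apply/funext => x; rewrite funeposE EFin_max.
rewrite (_ : _^\- = fun x => (Num.max ((- f) x) 0)%:E)%E; last first.
  by apply/funext => x; rewrite funenegE EFin_max.
exact/pos/C0_opp.
Qed.

End C0_functions.

(** * A nonzero charge annihilating C_0(X) *)

Theorem theorem3p13 (R : realType) (X : ptopologicalType)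
    (X_lc : locally_compact [set: X]) (X_hausdorff : hausdorff_space X)
    (X_nonradon : signed_radon R X <> [set: signed_measure R X]) :
  ~ exists k : X -> X -> R,
      is_C0_kernel k /\ strictly_ipd [set: signed_measure R X] k.
Proof.
move=> [k [[_ _ _ [H [dot [[Hhilb Hk _] HC0]]]] ipd]].
have [mu nmu] : exists mu : signed_measure R X, ~ signed_radon R X mu.
  by apply/existsNP => allR; apply: X_nonradon; apply/seteqP; split.
have [P [N PN]] := Hahn_decomposition mu.
pose p : {finite_measure set _ -> \bar R} := jordan_pos PN.
pose n : {finite_measure set _ -> \bar R} := jordan_neg PN.
have [p' rp' pp'] := exists_radon_superlevel X_lc X_hausdorff p.
have [n' rn' nn'] := exists_radon_superlevel X_lc X_hausdorff n.
(* With [p'] and [n'] the Radon companions of the Jordan parts of [mu], this is [mu - (p' - n')].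
   Were it zero, [mu] would be the signed Radon measure [p' - n']. *)
pose sg : signed_measure R X := cadd mu
  (cadd (charge_of_finite_measure n') (copp (charge_of_finite_measure p'))).
have sgE B : sg B = (mu B + (n' B - p' B))%E by [].
have sg_neq0 : charge_nonzero sg.
  apply: contrapT => sg0; apply: nmu; exists p', n'; split => // B mB.
  have : sg B = 0%E by apply: contrapT => sgB; apply: sg0; exists B.
  rewrite sgE => sgB.
  have finD : (n' B - p' B)%E \is a fin_num.
    by rewrite fin_numB !fin_num_measure.
  rewrite -[LHS](addeK _ finD) sgB sub0e.
  by rewrite fin_num_oppeB ?fin_num_measure// addeC.
have sg_C0 f : C0 f -> charge_integral sg f = 0.
  move=> Cf; have mf : measurable_fun setT (f : borelType X -> R).
    by apply: continuous_borel_measurable; case: Cf.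
  have bf := C0_bounded Cf.
  have intf (m : {finite_measure set (borelType X) -> \bar R}) :
      m.-integrable setT (EFin \o f).
    apply: measurable_bounded_integrable => //.
    by rewrite ltey_eq fin_num_measure.
  (* Since [mu = p - n], the charge [sg] is the difference of [p + n'] and [n + p'], which integrate
     [f] equally. *)
  rewrite (@charge_integral_difference _ _ _ sg (measure_add p n')
    (measure_add n p'))//.
  - rewrite /Rintegral !integral_measure_add//; try exact: intf.
    by rewrite -(eq_integral_C0 pp' Cf) -(eq_integral_C0 nn' Cf)
      [X in fine X - _]addeC subrr.
  - by rewrite [X in (X < _)%E]measure_addE ltey_eq fin_numD !fin_num_measure.
  - by rewrite [X in (X < _)%E]measure_addE ltey_eq fin_numD !fin_num_measure.
  - move=> B mB; rewrite [X in (_ + X)%E]measure_addE [RHS]measure_addE sgE.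
    rewrite (jordan_decomp PN mB) /cadd/= cscaleN1/= -/p -/n.
    rewrite addeACA subeK ?fin_num_measure// subeK ?fin_num_measure//.
have : 0 < charge_integral sg (fun y => charge_integral sg (k ^~ y)).
  exact: ipd.
rewrite (_ : (fun y => _) = fun=> 0); last first.
  by apply/funext => y; apply: sg_C0; apply: HC0; exact: Hk.
(* The remaining outer integrand is the zero function; it belongs to [H], hence to C_0(X), so
   [sg_C0] applies a second time. *)
by rewrite sg_C0 ?ltxx//; apply: HC0; exact: hfs_0 Hhilb.
Qed.
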